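(* For any $k\in\mathbb{Z}$ let $\mathfrak{h}_k^{\mathbb{Q}}$ be the rational Lie algebra with basis $X_1,\dots,X_4,Z_1,\dots,Z_4$ and Lie bracket $$[X_1,X_2]=Z_1,\quad [X_1,X_3]=Z_2,\quad [X_1,X_4]=kZ_3,\quad [X_2,X_3]=-Z_3,\quad [X_2,X_4]=-Z_2,\quad [X_3,X_4]=Z_4.$$ Let $\mathfrak{h}$ be the real Lie algebra with basis $X_1,\dots,X_4,Z_1,\dots,Z_4$ and Lie bracket $$[X_1,X_3]=Z_1,\quad [X_1,X_4]=Z_2,\quad [X_2,X_3]=Z_3,\quad [X_2,X_4]=Z_4.$$ (In both cases brackets of basis elements not determined by these via antisymmetry are zero.) Then the set of isomorphism classes of rational forms of $\mathfrak{h}$ is parametrized by $$\{\mathfrak{h}_k^{\mathbb{Q}} : k \text{ is a square-free natural number}\}.$$ That is, for each square-free natural number $k$, $\mathfrak{h}$ has a rational form isomorphic to $\mathfrak{h}_k^{\mathbb{Q}}$; every rational form of $\mathfrak{h}$ is isomorphic to some such $\mathfrak{h}_k^{\mathbb{Q}}$; and $\mathfrak{h}_k^{\mathbb{Q}}\not\simeq\mathfrak{h}_{k'}^{\mathbb{Q}}$ for distinct square-free natural numbers $k\neq k'$.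
   Context: A rational form of a real Lie algebra $\mathfrak{n}$ of dimension $n$ is an $n$-dimensional $\mathbb{Q}$-subspace $\mathfrak{n}^{\mathbb{Q}}\subset\mathfrak{n}$, closed under the Lie bracket, with $\mathfrak{n}^{\mathbb{Q}}\otimes\mathbb{R}=\mathfrak{n}$. Two rational forms of $\mathfrak{n}$ are isomorphic if some automorphism of $\mathfrak{n}$ maps one onto the other, equivalently if they are isomorphic as Lie algebras over $\mathbb{Q}$. A natural number $k\ge 1$ is square-free if $p^2\nmid k$ for every prime $p$ (so $1$ is square-free). *)

(* Defs.v *)
From HB Require Import structures.
From mathcomp Require Import all_boot all_order all_algebra.
From mathcomp Require Import all_classical all_reals.
From mathcomp Require Import ring.

Set Implicit Arguments.
Unset Strict Implicit.
Unset Printing Implicit Defensive.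

Import Order.TTheory GRing.Theory Num.Theory.

Local Open Scope classical_set_scope.
Local Open Scope ring_scope.

Reserved Notation "[lie u , v ]"
  (at level 0, u, v at level 99, format "[lie  u ,  v ]").

HB.mixin Record Vector_isLieAlgebra (K : fieldType) L of Vector K L := {
  lie_bracket : L -> L -> L;
  lie_linearr : forall u : L, linear (lie_bracket u);
  lie_linearl : forall v : L, linear (lie_bracket^~ v);
  lie_alt : forall u : L, lie_bracket u u = 0;
  lie_jacobi : forall u v w : L,
    lie_bracket u (lie_bracket v w) + lie_bracket v (lie_bracket w u)
      + lie_bracket w (lie_bracket u v) = 0
}.

#[short(type="lieAlgType")]
HB.structure Definition LieAlgebra (K : fieldType) :=
  {L of Vector K L & Vector_isLieAlgebra K L}.

Notation "[lie u , v ]" := (lie_bracket u v) : ring_scope.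

Definition lie_isomorphic (K : fieldType) (L M : lieAlgType K) : Prop :=
  exists f : {linear L -> M},
    bijective f /\ forall u v, f [lie u, v] = [lie f u, f v].

Section RationalForms.
Variables (R : realType) (L : lieAlgType R).

Definition rat_subspace (W : set L) : Prop :=
  W 0 /\ forall (q : rat) (u v : L), W u -> W v -> W (ratr q *: u + v).

Definition rat_basis (W : set L) (n : nat) (b : n.-tuple L) : Prop :=
  (forall i : 'I_n, W (tnth b i)) /\
  (forall v, W v ->
     exists! q : {ffun 'I_n -> rat}, v = \sum_i ratr (q i) *: tnth b i).

(* If b is a Q-basis of W, then W (x) R has R-basis (b_i (x) 1), so the
   canonical map W (x) R -> L, v (x) r |-> r *: v, is an isomorphism exactly
   when b is an R-basis of L. *)
Definition rational_form (W : set L) : Prop :=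
  [/\ rat_subspace W,
      forall u v, W u -> W v -> W [lie u, v] &
      exists b : (\dim {:L}).-tuple L, rat_basis W b /\ basis_of {:L} b].

(* W is regarded as a Lie algebra over Q; f is Q-linear, the scalars acting
   on L through ratr : rat -> R. *)
Definition form_isomorphic (W : set L) (M : lieAlgType rat) : Prop :=
  exists f : {linear M -> L | ratr \; *:%R},
    [/\ injective f, range f = W &
        forall u v, f [lie u, v] = [lie f u, f v]].

End RationalForms.

Section Table.
Variables (K : fieldType).

Definition basisX (i : nat) : 'rV[K]_8 := delta_mx 0 (inord i.-1).
Definition basisZ (i : nat) : 'rV[K]_8 := delta_mx 0 (inord (4 + i.-1)).

(* The alternating bilinear map with [X_i, X_j] = T i j for 1 <= i < j <= 4
   and with all brackets involving some Z_i equal to zero; see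
   table_bracketXX and table_bracketZ. *)
Definition table_bracket (T : nat -> nat -> 'rV[K]_8) (u v : 'rV[K]_8) :
    'rV[K]_8 :=
  \sum_(i < 4) \sum_(j < 4 | (i < j)%N)
    (u 0 (inord i) * v 0 (inord j) - u 0 (inord j) * v 0 (inord i))
      *: T i.+1 j.+1.

Lemma basisZ_central (i : nat) (m : 'I_4) : (1 <= i <= 4)%N ->
  basisZ i 0 (inord m) = 0.
Proof.
case: i => // i /= i4; rewrite mxE -[inord m == _]val_eqE /= !inordK //.
  by rewrite ltn_eqF // (leq_trans (ltn_ord m)) ?leq_addr.
exact: leq_trans (ltn_ord m) _.
Qed.

Variable T : nat -> nat -> 'rV[K]_8.

Lemma table_bracket_linearr (u : 'rV[K]_8) : linear (table_bracket T u).
Proof.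
move=> a v w; rewrite /table_bracket scaler_sumr -big_split /=.
apply: eq_bigr => i _; rewrite scaler_sumr -big_split /=.
apply: eq_bigr => j _; rewrite scalerA -scalerDl !mxE; congr (_ *: _).
ring.
Qed.

Lemma table_bracket_linearl (v : 'rV[K]_8) : linear ((table_bracket T)^~ v).
Proof.
move=> a u w; rewrite /table_bracket scaler_sumr -big_split /=.
apply: eq_bigr => i _; rewrite scaler_sumr -big_split /=.
apply: eq_bigr => j _; rewrite scalerA -scalerDl !mxE; congr (_ *: _).
ring.
Qed.

Lemma table_bracket_alt (u : 'rV[K]_8) : table_bracket T u u = 0.
Proof.
rewrite /table_bracket big1 // => i _; rewrite big1 // => j _.
by rewrite [u 0 (inord j) * _]mulrC subrr scale0r.
Qed.

Lemma table_bracketXX (i j : nat) : (1 <= i)%N -> (i < j)%N -> (j <= 4)%N ->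
  table_bracket T (basisX i) (basisX j) = T i j.
Proof.
case: i => // i _; case: j => // j; rewrite !ltnS => ij j3.
have i4 : (i < 4)%N by apply: ltn_trans ij _; rewrite ltnS.
have j4 : (j < 4)%N by rewrite ltnS.
have inE (a b : nat) : (a < 4)%N -> (b < 4)%N ->
    (@inord 7 a == inord b) = (a == b).
  move=> a4 b4; rewrite -val_eqE /= !inordK //.
    by apply: leq_trans b4 _.
  by apply: leq_trans a4 _.
rewrite /table_bracket /basisX /= (bigD1 (Ordinal i4)) //=.
rewrite (bigD1 (Ordinal j4)) //= !mxE !inE // !eqxx /= big1 => [|l].
  rewrite big1 => [|l /negPf l_i].
    by rewrite gtn_eqF // ltn_eqF // mulr1 mul0r subr0 scale1r !addr0.
  rewrite big1 // => m lm; rewrite !mxE !inE //.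
  have -> : (l == i :> nat) = false by exact: l_i.
  rewrite andbF mul0r sub0r eqxx /=; case: (eqVneq (m : nat) i) => [mi|_].
    case: (eqVneq (l : nat) j) => [lj|_]; last by rewrite mulr0 oppr0 scale0r.
    by move: lm ij; rewrite mi lj => a b; move: (ltn_trans a b); rewrite ltnn.
  by rewrite mul0r oppr0 scale0r.
case/andP => il /negPf l_j; rewrite !mxE !inE //.
have -> : (l == j :> nat) = false by exact: l_j.
by rewrite !(gtn_eqF il) mulr0 mul0r subrr scale0r.
Qed.

Lemma table_bracketZ (i : nat) (u : 'rV[K]_8) : (1 <= i <= 4)%N ->
  table_bracket T u (basisZ i) = 0 /\ table_bracket T (basisZ i) u = 0.
Proof.
move=> i4; have Z0 (m : 'I_4) := basisZ_central m i4.
split; rewrite /table_bracket big1 // => l _; rewrite big1 // => m _.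
  by rewrite !Z0 !mulr0 subrr scale0r.
by rewrite !Z0 !mul0r subrr scale0r.
Qed.

Hypothesis T_central : forall i j (m : 'I_4), T i j 0 (inord m) = 0.

Lemma table_bracket_nil (u v w : 'rV[K]_8) :
  table_bracket T u (table_bracket T v w) = 0.
Proof.
have T0 (m : 'I_4) : table_bracket T v w 0 (inord m) = 0.
  rewrite /table_bracket summxE big1 // => i _.
  by rewrite summxE big1 // => j _; rewrite mxE T_central mulr0.
rewrite /(table_bracket T u) big1 // => i _; rewrite big1 // => j _.
by rewrite !T0 !mulr0 subrr scale0r.
Qed.

Lemma table_bracket_jacobi (u v w : 'rV[K]_8) :
  table_bracket T u (table_bracket T v w)
    + table_bracket T v (table_bracket T w u)
    + table_bracket T w (table_bracket T u v) = 0.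
Proof. by rewrite !table_bracket_nil !addr0. Qed.

End Table.

Definition hQ_table (k : int) (i j : nat) : 'rV[rat]_8 :=
  match i, j with
  | 1%N, 2%N => basisZ rat 1
  | 1%N, 3%N => basisZ rat 2
  | 1%N, 4%N => k%:~R *: basisZ rat 3
  | 2%N, 3%N => - basisZ rat 3
  | 2%N, 4%N => - basisZ rat 2
  | 3%N, 4%N => basisZ rat 4
  | _, _ => 0
  end.

Lemma hQ_table_central (k : int) (i j : nat) (m : 'I_4) :
  hQ_table k i j 0 (inord m) = 0.
Proof.
have Z0 l : (1 <= l <= 4)%N -> basisZ rat l 0 (inord m) = 0.
  exact: basisZ_central.
have ZN l : (1 <= l <= 4)%N -> (- basisZ rat l) 0 (inord m) = 0.
  by move=> l4; rewrite mxE Z0 ?oppr0.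
have Zk l : (1 <= l <= 4)%N -> (k%:~R *: basisZ rat l) 0 (inord m) = 0.
  by move=> l4; rewrite mxE Z0 ?mulr0.
by case: i j => [|[|[|[|i]]]] [|[|[|[|[|j]]]]]; rewrite /= ?Z0 ?ZN ?Zk // mxE.
Qed.

Definition hQ (k : int) : Type := 'rV[rat]_8.

HB.instance Definition _ (k : int) := Vector.on (hQ k).
HB.instance Definition _ (k : int) := Vector_isLieAlgebra.Build rat (hQ k)
  (table_bracket_linearr (hQ_table k)) (table_bracket_linearl (hQ_table k))
  (table_bracket_alt (hQ_table k))
  (table_bracket_jacobi (hQ_table_central k)).

Section RealAlgebra.
Variable R : realType.

Definition h_table (i j : nat) : 'rV[R]_8 :=
  match i, j with
  | 1%N, 3%N => basisZ R 1
  | 1%N, 4%N => basisZ R 2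
  | 2%N, 3%N => basisZ R 3
  | 2%N, 4%N => basisZ R 4
  | _, _ => 0
  end.

Lemma h_table_central (i j : nat) (m : 'I_4) : h_table i j 0 (inord m) = 0.
Proof.
by case: i j => [|[|[|i]]] [|[|[|[|[|j]]]]]; rewrite /= ?basisZ_central ?mxE.
Qed.

Definition h : Type := 'rV[R]_8.

HB.instance Definition _ := Vector.on h.
HB.instance Definition _ := Vector_isLieAlgebra.Build R h
  (table_bracket_linearr h_table) (table_bracket_linearl h_table)
  (table_bracket_alt h_table) (table_bracket_jacobi h_table_central).

End RealAlgebra.

Definition square_free (k : nat) : Prop :=
  (1 <= k)%N /\ forall p : nat, prime p -> ~~ (p ^ 2 %| k)%N.

(* Main.v *)
Require Import Defs.
From HB Require Import structures.
From mathcomp Require Import all_boot all_order all_algebra.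
From mathcomp Require Import all_classical all_reals.
From mathcomp Require Import ring lra zify.

Set Implicit Arguments.
Unset Strict Implicit.
Unset Printing Implicit Defensive.

Import Order.TTheory GRing.Theory Num.Theory.

Local Open Scope classical_set_scope.
Local Open Scope ring_scope.

(* Write V1 = <X1, X2> and V2 = <X3, X4> for the two planes of h modulo its
   centre.  The linear maps T of h with [T x, y] = - [x, T y] are, modulo the
   centre, exactly the multiples c * sigma of the involution sigma which is 1
   on V1 and -1 on V2.  This condition is a linear system whose coefficients
   are rational in a basis of a rational form W, so W has a T of its own with
   c <> 0; then c ^ 2 is rational, and rescaling T makes it a square-free
   natural number k.  For X1 and X3 generic in W, the vectors X1, T X1 / k, X3
   and T X3 satisfy the relations of h_k^Q and generate W.  Conversely h_k^Q
   carries a T with T ^ 2 = k modulo the centre, and any other T' with the same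
   skewness has T' ^ 2 = c ^ 2 * k with c rational: k is determined up to a
   rational square. *)

(** * Square-free parts of natural numbers *)

Lemma square_free_part (n : nat) : (0 < n)%N ->
  exists m k : nat, [/\ (0 < m)%N, square_free k & n = (m ^ 2 * k)%N].
Proof.
elim/ltn_ind: n => n IH n0.
case: (pselect (exists2 p, prime p & (p ^ 2 %| n)%N)) => [[p pp dv]|nex]; last first.
  exists 1%N, n; split; rewrite ?mul1n //; split => // p pp.
  by apply/negP => dv; apply: nex; exists p.
have p2 : (1 < p ^ 2)%N by rewrite -{1}(exp1n 2) ltn_exp2r // prime_gt1.
have q0 : (0 < n %/ p ^ 2)%N by rewrite divn_gt0 ?(dvdn_leq n0 dv) // (ltnW p2).
have [m [k [m0 sk e]]] := IH _ (ltn_Pdiv p2 n0) q0.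
exists (m * p)%N, k; split => //; first by rewrite muln_gt0 m0 prime_gt0.
by rewrite -{1}(divnK dv) e expnMn mulnAC.
Qed.

Lemma square_free_logn (k p : nat) : square_free k -> (logn p k <= 1)%N.
Proof.
move=> [k0 sk]; case: (boolP (prime p)) => pp; last by rewrite lognE (negPf pp).
by rewrite leqNgt -(pfactor_dvdn _ pp k0) // sk.
Qed.

(** Clearing the denominator of [c] gives [b ^ 2 * k = a ^ 2 * k']. At each prime the valuations of
    [k] and [k'] then have the same parity, and both are at most 1. *)
Lemma square_free_inj (k k' : nat) (c : rat) :
  square_free k -> square_free k' -> k%:R = c ^+ 2 * k'%:R -> k = k'.
Proof.
move=> sk sk' e.
have k0 : (0 < k)%N by case: sk.
have k'0 : (0 < k')%N by case: sk'.
pose a := `|numq c|%N; pose b := `|denq c|%N.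
have b0 : (0 < b)%N by rewrite absz_gt0 denq_neq0.
have E : (b ^ 2 * k = a ^ 2 * k')%N.
  apply/eqP; rewrite -(eqr_nat rat) -!mulnn !natrM -!expr2.
  have -> : (b%:R : rat) ^+ 2 = (denq c)%:~R ^+ 2.
    by rewrite /b natr_absz intr_norm real_normK ?num_real.
  have -> : (a%:R : rat) ^+ 2 = (numq c)%:~R ^+ 2.
    by rewrite /a natr_absz intr_norm real_normK ?num_real.
  by rewrite numqE e; apply/eqP; ring.
have a0 : (0 < a)%N.
  by rewrite lt0n; apply: contra_eqN E => /eqP->; rewrite muln_eq0 expn_eq0; lia.
apply: eqn_from_log => // p.
have /(congr1 (logn p)) := E; rewrite -!mulnn !lognM ?muln_gt0 ?a0 ?b0 //.
have := square_free_logn p sk; have := square_free_logn p sk'.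
by lia.
Qed.

(** * Coordinates of vectors of length 8 *)

(** Indices start at 0: the coordinates 0 to 3 belong to [X_1], ..., [X_4] and 4 to 7 to the central
    [Z_1], ..., [Z_4]. With [nat] literals as indices, vector identities become polynomial ones for
    [ring]. *)
Definition coord (K : fieldType) (x : 'rV[K]_8) (i : nat) : K := x 0 (inord i).
Arguments coord {K} x i%_N.

Section Coord.
Variable K : fieldType.
Implicit Types (x y : 'rV[K]_8).

Lemma coordD x y i : coord (x + y) i = coord x i + coord y i.
Proof. by rewrite /coord mxE. Qed.
Lemma coordN x i : coord (- x) i = - coord x i.
Proof. by rewrite /coord mxE. Qed.
Lemma coordZ a x i : coord (a *: x) i = a * coord x i.
Proof. by rewrite /coord mxE. Qed.
Lemma coord0 i : coord (0 : 'rV[K]_8) i = 0.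
Proof. by rewrite /coord mxE. Qed.

Lemma coord_inj x y :
  coord x 0 = coord y 0 -> coord x 1 = coord y 1 -> coord x 2 = coord y 2 ->
  coord x 3 = coord y 3 -> coord x 4 = coord y 4 -> coord x 5 = coord y 5 ->
  coord x 6 = coord y 6 -> coord x 7 = coord y 7 -> x = y.
Proof.
move=> e0 e1 e2 e3 e4 e5 e6 e7; apply/rowP => i.
rewrite -(inord_val i); case: i => i /= i8.
by move: i i8; do 8! [case => // ].
Qed.

Lemma coord_delta i j : (i < 8)%N -> (j < 8)%N ->
  coord (delta_mx 0 (inord i) : 'rV[K]_8) j = (j == i)%:R.
Proof. by move=> i8 j8; rewrite /coord mxE eqxx -val_eqE /= !inordK. Qed.

Lemma coord_basisX i j : (i < 8)%N -> (j < 8)%N ->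
  coord (basisX K i.+1) j = (j == i)%:R.
Proof. exact: coord_delta. Qed.

Lemma coord_basisZ i j : (i < 4)%N -> (j < 8)%N ->
  coord (basisZ K i.+1) j = (j == (4 + i)%N)%:R.
Proof. by move=> i8; apply: coord_delta; rewrite ltn_add2l in i8 *. Qed.

Lemma big_ord8 (V : nmodType) (F : 'I_8 -> V) :
  \sum_i F i = F (inord 0) + F (inord 1) + F (inord 2) + F (inord 3)
    + F (inord 4) + F (inord 5) + F (inord 6) + F (inord 7).
Proof.
rewrite !big_ord_recr big_ord0 /= add0r.
by do !congr (_ + _); congr F; apply/val_inj; rewrite /= ?inordK.
Qed.

Lemma table_bracketE (T : nat -> nat -> 'rV[K]_8) x y :
  table_bracket T x y =
    (coord x 0 * coord y 1 - coord x 1 * coord y 0) *: T 1%N 2%N +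
    (coord x 0 * coord y 2 - coord x 2 * coord y 0) *: T 1%N 3%N +
    (coord x 0 * coord y 3 - coord x 3 * coord y 0) *: T 1%N 4%N +
    (coord x 1 * coord y 2 - coord x 2 * coord y 1) *: T 2%N 3%N +
    (coord x 1 * coord y 3 - coord x 3 * coord y 1) *: T 2%N 4%N +
    (coord x 2 * coord y 3 - coord x 3 * coord y 2) *: T 3%N 4%N.
Proof.
have ord4 (V : nmodType) (F : 'I_4 -> V) : \sum_i F i =
    F (inord 0) + F (inord 1) + F (inord 2) + F (inord 3).
  rewrite !big_ord_recr big_ord0 /= add0r.
  by do !congr (_ + _); congr F; apply/val_inj; rewrite /= ?inordK.
rewrite /table_bracket /coord ord4 !inordK //.
do 4!rewrite [\sum_(j < 4 | _) _]big_mkcond /= ord4.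
by rewrite !inordK //= ?(add0r, addr0) !addrA.
Qed.
End Coord.

(** * The two Lie brackets in coordinates *)

Section Brackets.
Variable R : realType.

Lemma h_lie_sum (x y : h R) i : (i < 8)%N -> coord [lie x, y] i =
  (coord x 0 * coord y 2 - coord x 2 * coord y 0) * (i == 4)%:R +
  (coord x 0 * coord y 3 - coord x 3 * coord y 0) * (i == 5)%:R +
  (coord x 1 * coord y 2 - coord x 2 * coord y 1) * (i == 6)%:R +
  (coord x 1 * coord y 3 - coord x 3 * coord y 1) * (i == 7)%:R.
Proof.
move=> i8; have -> : [lie x, y] = table_bracket (@h_table R) x y by [].
rewrite table_bracketE !(coordD, coordZ) /h_table !coord_basisZ // !coord0.
by rewrite !mulr0 addr0 add0r.
Qed.

Lemma hQ_lie_sum (k : int) (x y : hQ k) i : (i < 8)%N -> coord [lie x, y] i =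
  (coord x 0 * coord y 1 - coord x 1 * coord y 0) * (i == 4)%:R +
  ((coord x 0 * coord y 2 - coord x 2 * coord y 0)
    - (coord x 1 * coord y 3 - coord x 3 * coord y 1)) * (i == 5)%:R +
  (k%:~R * (coord x 0 * coord y 3 - coord x 3 * coord y 0)
    - (coord x 1 * coord y 2 - coord x 2 * coord y 1)) * (i == 6)%:R +
  (coord x 2 * coord y 3 - coord x 3 * coord y 2) * (i == 7)%:R.
Proof.
move=> i8; have -> : [lie x, y] = table_bracket (hQ_table k) x y by [].
rewrite table_bracketE !(coordD, coordZ) /hQ_table !(coordN, coordZ).
by rewrite !coord_basisZ //; ring.
Qed.

Lemma h_lie0 (x y : h R) : coord [lie x, y] 0 = 0.
Proof. by rewrite h_lie_sum //=; ring. Qed.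
Lemma h_lie1 (x y : h R) : coord [lie x, y] 1 = 0.
Proof. by rewrite h_lie_sum //=; ring. Qed.
Lemma h_lie2 (x y : h R) : coord [lie x, y] 2 = 0.
Proof. by rewrite h_lie_sum //=; ring. Qed.
Lemma h_lie3 (x y : h R) : coord [lie x, y] 3 = 0.
Proof. by rewrite h_lie_sum //=; ring. Qed.
Lemma h_lie4 (x y : h R) : coord [lie x, y] 4 =
  coord x 0 * coord y 2 - coord x 2 * coord y 0.
Proof. by rewrite h_lie_sum //=; ring. Qed.
Lemma h_lie5 (x y : h R) : coord [lie x, y] 5 =
  coord x 0 * coord y 3 - coord x 3 * coord y 0.
Proof. by rewrite h_lie_sum //=; ring. Qed.
Lemma h_lie6 (x y : h R) : coord [lie x, y] 6 =
  coord x 1 * coord y 2 - coord x 2 * coord y 1.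
Proof. by rewrite h_lie_sum //=; ring. Qed.
Lemma h_lie7 (x y : h R) : coord [lie x, y] 7 =
  coord x 1 * coord y 3 - coord x 3 * coord y 1.
Proof. by rewrite h_lie_sum //=; ring. Qed.

Definition h_lieE := (h_lie0, h_lie1, h_lie2, h_lie3, h_lie4, h_lie5, h_lie6, h_lie7).

Lemma hQ_lie0 (k : int) (x y : hQ k) : coord [lie x, y] 0 = 0.
Proof. by rewrite hQ_lie_sum //=; ring. Qed.
Lemma hQ_lie1 (k : int) (x y : hQ k) : coord [lie x, y] 1 = 0.
Proof. by rewrite hQ_lie_sum //=; ring. Qed.
Lemma hQ_lie2 (k : int) (x y : hQ k) : coord [lie x, y] 2 = 0.
Proof. by rewrite hQ_lie_sum //=; ring. Qed.
Lemma hQ_lie3 (k : int) (x y : hQ k) : coord [lie x, y] 3 = 0.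
Proof. by rewrite hQ_lie_sum //=; ring. Qed.
Lemma hQ_lie4 (k : int) (x y : hQ k) : coord [lie x, y] 4 =
  coord x 0 * coord y 1 - coord x 1 * coord y 0.
Proof. by rewrite hQ_lie_sum //=; ring. Qed.
Lemma hQ_lie5 (k : int) (x y : hQ k) : coord [lie x, y] 5 =
  (coord x 0 * coord y 2 - coord x 2 * coord y 0)
    - (coord x 1 * coord y 3 - coord x 3 * coord y 1).
Proof. by rewrite hQ_lie_sum //=; ring. Qed.
Lemma hQ_lie6 (k : int) (x y : hQ k) : coord [lie x, y] 6 =
  k%:~R * (coord x 0 * coord y 3 - coord x 3 * coord y 0)
    - (coord x 1 * coord y 2 - coord x 2 * coord y 1).
Proof. by rewrite hQ_lie_sum //=; ring. Qed.
Lemma hQ_lie7 (k : int) (x y : hQ k) : coord [lie x, y] 7 =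
  coord x 2 * coord y 3 - coord x 3 * coord y 2.
Proof. by rewrite hQ_lie_sum //=; ring. Qed.

Definition hQ_lieE := (hQ_lie0, hQ_lie1, hQ_lie2, hQ_lie3, hQ_lie4, hQ_lie5, hQ_lie6, hQ_lie7).
End Brackets.

(** * Embeddings of [hQ k] into [h], and rational forms as matrices *)

Section Embedding.
Variable R : realType.
Implicit Types (E : 'M[R]_8) (k : int).

Definition embed k E (x : hQ k) : h R := map_mx ratr x *m E.

Lemma embed_is_linear k E : GRing.linear_for (ratr \; *:%R) (@embed k E).
Proof. by move=> a x y; rewrite /embed map_mxD map_mxZ mulmxDl -scalemxAl. Qed.

HB.instance Definition _ k E :=
  GRing.isLinear.Build rat (hQ k) (h R) (ratr \; *:%R) (@embed k E)
    (@embed_is_linear k E).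

Lemma coord_embed k E (x : hQ k) j :
  coord (embed E x) j = \sum_i ratr (x 0 i) * coord (row i E) j.
Proof. by rewrite /coord mxE; apply: eq_bigr => i _; rewrite !mxE. Qed.

Lemma embed_inj k E : E \in unitmx -> injective (@embed k E).
Proof.
move=> uE x y /(congr1 (mulmx^~ (invmx E))); rewrite /= !mulmxK //.
by move=> /matrixP e; apply/matrixP => i j; have := e i j; rewrite !mxE => /fmorph_inj.
Qed.

Lemma dim_h : \dim {:h R} = 8%N.
Proof. by rewrite dimvf. Qed.

(** The length is a variable because the bases in [rational_form] have length [\dim {:h R}], which
    becomes 8 only by rewriting with [dim_h]. *)
Lemma basis_of_rows n (b : n.-tuple (h R)) : n = 8%N ->
  basis_of {:h R} b = row_free (\matrix_(i < n) (tnth b i : 'rV[R]_8)).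
Proof.
move=> n8; rewrite basisEfree subvf dim_h size_tuple.
have -> : (8 <= n)%N by rewrite n8.
rewrite !andbT.
set M := \matrix_i _.
have ME (a : 'rV[R]_n) : a *m M = \sum_i a 0 i *: (b`_i : h R).
  by rewrite mulmx_sum_row; apply: eq_bigr => i _; rewrite rowK -tnth_nth.
apply/freeP/idP => [fb|fM a].
  rewrite -kermx_eq0; apply/rowV0P => a /sub_kermxP; rewrite ME => /fb a0.
  by apply/rowP => i; rewrite mxE a0.
have -> : \sum_(i < n) a i *: b`_i = (\row_i a i) *m M.
  by rewrite ME; apply: eq_bigr => i _; rewrite mxE.
move=> aM0; have : \row_i a i *m M = 0 *m M by rewrite mul0mx.
move=> /(row_free_inj fM) /rowP a0 i.
by have := a0 i; rewrite !mxE.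
Qed.

(** The rows of [E] serve both as a rational basis of the image and as a real basis of [h]. *)
Lemma embed_rational_form k E : E \in unitmx ->
  (forall x y : hQ k, embed E [lie x, y] = [lie embed E x, embed E y]) ->
  rational_form (range (@embed k E)).
Proof.
move=> uE lieE; split.
- split; first by exists 0 => //; rewrite linear0.
  move=> q _ _ [x _ <-] [y _ <-]; exists (q *: x + y) => //.
  exact: linearP.
- by move=> _ _ [x _ <-] [y _ <-]; exists [lie x, y].
(* With the lemma in the goal, one rewrite changes the length of the tuples in both. *)
move: (basis_of_rows (n := \dim {:h R})).
rewrite dim_h => dim8.
pose b : 8.-tuple (h R) := [tuple row i E | i < 8].
exists b; split; last first.
  rewrite dim8 // row_free_unit; suff -> : \matrix_i (tnth b i : 'rV[R]_8) = E by [].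
  by apply/row_matrixP => i; rewrite rowK tnth_mktuple.
have bE (q : 'rV[rat]_8) : embed E (q : hQ k) = \sum_i ratr (q 0 i) *: tnth b i.
  rewrite /embed mulmx_sum_row; apply: eq_bigr => i _.
  by rewrite tnth_mktuple mxE.
split=> [i|_ [x _ <-]].
  exists (delta_mx 0 i) => //; rewrite tnth_mktuple /embed.
  by rewrite map_delta_mx -rowE.
exists [ffun i => x 0 i]; split.
  by rewrite bE; apply: eq_bigr => i _; rewrite ffunE.
move=> q; have -> : \sum_i ratr (q i) *: tnth b i = embed E (\row_i q i : hQ k).
  by rewrite bE; apply: eq_bigr => i _; rewrite mxE.
move=> /(embed_inj uE) ->; apply/ffunP => i; by rewrite ffunE mxE.
Qed.

Lemma rational_form_rows (W : set (h R)) : rational_form W ->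
  exists2 B : 'M[R]_8, B \in unitmx &
    W = [set v | exists q : 'rV[rat]_8, v = map_mx ratr q *m B].
Proof.
move=> [sW _]; have := basis_of_rows (n := \dim {:h R}).
rewrite dim_h => bu [b [[bW bs] bb]].
exists (\matrix_i (tnth b i : 'rV[R]_8)); first by rewrite -row_free_unit -bu.
have bE (q : 'rV[rat]_8) : map_mx ratr q *m (\matrix_i (tnth b i : 'rV[R]_8))
    = \sum_i ratr (q 0 i) *: tnth b i.
  rewrite mulmx_sum_row; apply: eq_bigr => i _.
  by rewrite rowK mxE.
apply/seteqP; split=> [v /bs[q [-> _]]|_ [q ->]] /=.
  exists (\row_i q i); rewrite bE.
  by apply: eq_bigr => i _; rewrite mxE.
rewrite bE; case: sW => W0 Wl.
by elim/big_rec: _ => [//|i v _ Wv]; apply: Wl.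
Qed.

End Embedding.

(** * Frames: generators of [h] that satisfy the relations of [hQ k] *)

(** Cramer's rule for a homogeneous system of two equations. *)
Lemma det2_inj (K : fieldType) (p q r s a b : K) :
  p * s - q * r != 0 -> a * p + b * q = 0 -> a * r + b * s = 0 ->
  a = 0 /\ b = 0.
Proof.
move=> D e f; split; apply: (mulIf D); rewrite mul0r.
  have -> : a * (p * s - q * r) = (a * p + b * q) * s - (a * r + b * s) * q by ring.
  by rewrite e f !mul0r subrr.
have -> : b * (p * s - q * r) = (a * r + b * s) * p - (a * p + b * q) * r by ring.
by rewrite e f !mul0r subrr.
Qed.

Section Frame.
Variable R : realType.

(* The rows are the images of X_1, ..., Z_4 of h_k^Q; the sign in the seventh
   one comes from [X_2, X_3] = - Z_3. *)
Definition frame (X1 X2 X3 X4 : h R) : 'M[R]_8 :=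
  \matrix_i (nth 0 [:: X1; X2; X3; X4; [lie X1, X2]; [lie X1, X3];
                       - [lie X2, X3]; [lie X3, X4]] i : 'rV[R]_8).

(* Modulo the centre, X2 = c^-1 * sigma X1 and X4 = c * sigma X3, where sigma
   is 1 on the plane of the first two coordinates and -1 on the next two. *)
Variables (c : R) (X1 X2 X3 X4 : h R).
Hypotheses (c0 : c != 0)
  (X20 : coord X2 0 = coord X1 0 / c) (X21 : coord X2 1 = coord X1 1 / c)
  (X22 : coord X2 2 = - (coord X1 2 / c)) (X23 : coord X2 3 = - (coord X1 3 / c))
  (X40 : coord X4 0 = c * coord X3 0) (X41 : coord X4 1 = c * coord X3 1)
  (X42 : coord X4 2 = - (c * coord X3 2)) (X43 : coord X4 3 = - (c * coord X3 3)).

Lemma coord_frame_sum (a : 'I_8 -> R) j :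
  \sum_i a i * coord (row i (frame X1 X2 X3 X4)) j =
  a (inord 0) * coord X1 j + a (inord 1) * coord X2 j + a (inord 2) * coord X3 j +
  a (inord 3) * coord X4 j + a (inord 4) * coord [lie X1, X2] j +
  a (inord 5) * coord [lie X1, X3] j - a (inord 6) * coord [lie X2, X3] j +
  a (inord 7) * coord [lie X3, X4] j.
Proof. by rewrite big_ord8 !rowK !inordK //= coordN mulrN. Qed.

(** The two determinants say that [X1] and [X3] project to a basis of each of the two planes. A
    linear relation between the rows is read first modulo the centre, then in the centre. *)
Lemma frame_unit :
  coord X1 0 * coord X3 1 - coord X3 0 * coord X1 1 != 0 ->
  coord X1 2 * coord X3 3 - coord X3 2 * coord X1 3 != 0 ->
  frame X1 X2 X3 X4 \in unitmx.
Proof.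
move=> D1 D2; rewrite -row_free_unit -kermx_eq0; apply/rowV0P => a /sub_kermxP aM.
have E j : \sum_i a 0 i * coord (row i (frame X1 X2 X3 X4)) j = 0.
  have := congr1 (fun v : 'rV[R]_8 => coord v j) aM.
  rewrite /coord /= [LHS]mxE [RHS]mxE => e; rewrite -[RHS]e.
  by apply: eq_bigr => i _; rewrite mxE.
have := E 0%N; have := E 1%N; have := E 2%N; have := E 3%N.
have := E 4%N; have := E 5%N; have := E 6%N; have := E 7%N.
rewrite !coord_frame_sum.
rewrite !h_lieE X20 X21 X22 X23 X40 X41 X42 X43.
move: D1 D2.
move: (coord X1 0) (coord X1 1) (coord X1 2) (coord X1 3) => p0 p1 p2 p3.
move: (coord X3 0) (coord X3 1) (coord X3 2) (coord X3 3) => q0 q1 q2 q3.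
move=> D1 D2 e7 e6 e5 e4 e3 e2 e1 e0.
have eqa : [/\ a 0 (inord 0) = 0, a 0 (inord 1) = 0, a 0 (inord 2) = 0 & a 0 (inord 3) = 0].
  move: e0 e1 e2 e3; rewrite !(mulr0, addr0, subr0).
  move: (a 0 (inord 0)) (a 0 (inord 1)) (a 0 (inord 2)) (a 0 (inord 3)) => a0 a1 a2 a3.
  move=> e0 e1 e2 e3.
  (* On the first plane [X2] and [X4] project to [X1 / c] and [c * X3], on the second to the
     opposites. The two planes thus give the same equations with opposite signs at [a1] and [a3]. *)
  have [f1 f2] : a0 + a1 / c = 0 /\ a2 + c * a3 = 0.
    by apply: (det2_inj D1); [rewrite -e0|rewrite -e1]; ring.
  have [f3 f4] : a0 - a1 / c = 0 /\ a2 - c * a3 = 0.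
    by apply: (det2_inj D2); [rewrite -e2|rewrite -e3]; ring.
  have a00 : a0 = 0 by lra.
  have a20 : a2 = 0 by lra.
  split=> //.
    by apply: (mulIf (invr_neq0 c0)); lra.
  by apply: (mulfI c0); lra.
case: eqa => a0 a1 a2 a3; move: e4 e5 e6 e7; rewrite a0 a1 a2 a3 !mul0r !add0r.
set a4 := a 0 (inord 4); set a5 := a 0 (inord 5).
set a6 := a 0 (inord 6); set a7 := a 0 (inord 7) => e4 e5 e6 e7.
(* The centre is the tensor product of the two planes. With [p] and [q] the projections of [X1] and
   [X3], the relation has coefficients [u], [v], [w], [z] on the tensors [p p], [p q], [q p], [q q],
   which are independent by [D1] and [D2]. *)
pose u := - 2 / c * a4; pose v := a5 - a6 / c; pose w := - a5 - a6 / c.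
pose z := - (2 * c) * a7.
have [f1 f2] : u * p2 + v * q2 = 0 /\ w * p2 + z * q2 = 0.
  by apply: (det2_inj D1); [rewrite -e4|rewrite -e6]; rewrite /u /v /w /z; field.
have [f3 f4] : u * p3 + v * q3 = 0 /\ w * p3 + z * q3 = 0.
  by apply: (det2_inj D1); [rewrite -e5|rewrite -e7]; rewrite /u /v /w /z; field.
have [u0 v0] := det2_inj D2 f1 f3; have [w0 z0] := det2_inj D2 f2 f4.
have a40 : a4 = 0.
  have -> : a4 = u * (- c / 2) by rewrite /u; field.
  by rewrite u0 mul0r.
have a50 : a5 = 0 by move: v0 w0; rewrite /v /w; lra.
have a60 : a6 = 0.
  have -> : a6 = - (v + w) * c / 2 by rewrite /v /w; field.
  by rewrite v0 w0 addr0 oppr0 !mul0r.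
have a70 : a7 = 0.
  have -> : a7 = - z / (2 * c) by rewrite /z; field.
  by rewrite z0 oppr0 mul0r.
by apply: (@coord_inj R a 0); rewrite coord0.
Qed.

(** The relations not built into the rows are [[X1, X4] = - k [X2, X3]] and [[X2, X4] = - [X1, X3]].
    Both come from [[sigma x, y] = - [x, sigma y]], the first together with [c ^+ 2 = k]. *)
Lemma frame_lie (k : nat) (x y : hQ k) : c ^+ 2 = k%:R ->
  embed (frame X1 X2 X3 X4) [lie x, y] =
  [lie embed (frame X1 X2 X3 X4) x, embed (frame X1 X2 X3 X4) y].
Proof.
move=> ck.
have E z j : coord (embed (frame X1 X2 X3 X4) z) j = 
  ratr (coord z 0) * coord X1 j + ratr (coord z 1) * coord X2 j +
  ratr (coord z 2) * coord X3 j + ratr (coord z 3) * coord X4 j +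
  ratr (coord z 4) * coord [lie X1, X2] j + ratr (coord z 5) * coord [lie X1, X3] j -
  ratr (coord z 6) * coord [lie X2, X3] j + ratr (coord z 7) * coord [lie X3, X4] j.
  by rewrite coord_embed coord_frame_sum.
have rk : ratr (k%:~R : rat) = c ^+ 2 by rewrite ck ratr_int.
have X := (X20, X21, X22, X23, X40, X41, X42, X43).
by apply: (@coord_inj R); rewrite !(h_lieE, E, hQ_lieE) ?X
  !(rmorphM, rmorphB, rmorph0) /= ?rk; field.
Qed.
End Frame.

(** * Bilinear expansion, and linear systems with rational coefficients *)

HB.instance Definition _ (K : fieldType) (L : lieAlgType K) (u : L) :=
  GRing.isLinear.Build K L L *:%R (lie_bracket u) (lie_linearr u).

Lemma lie_suml (K : fieldType) (L : lieAlgType K) n (a : 'I_n -> K)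
    (F : 'I_n -> L) (v : L) :
  [lie \sum_i a i *: F i, v] = \sum_i a i *: [lie F i, v].
Proof.
pose f : {linear L -> L} := HB.pack (lie_bracket^~ v)
  (GRing.isLinear.Build K L L *:%R (lie_bracket^~ v) (lie_linearl v)).
have -> : [lie \sum_i a i *: F i, v] = f (\sum_i a i *: F i) by [].
by rewrite linear_sum; apply: eq_bigr => i _; rewrite linearZ.
Qed.

Lemma lie_sumr (K : fieldType) (L : lieAlgType K) n (a : 'I_n -> K)
    (F : 'I_n -> L) (u : L) :
  [lie u, \sum_i a i *: F i] = \sum_i a i *: [lie u, F i].
Proof. by rewrite linear_sum; apply: eq_bigr => i _; rewrite linearZ. Qed.

(** Meant for systems whose unknowns are the entries of a matrix: the indicator keeps the unknowns
    of row [i]. *)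
Lemma sum_pair_pick (K : comNzRingType) n (x : 'I_n * 'I_n -> K) i (f : 'I_n -> K) :
  \sum_p x p * ((p.1 == i)%:R * f p.2) = \sum_l x (i, l) * f l.
Proof.
have -> : \sum_p x p * ((p.1 == i)%:R * f p.2) =
    \sum_p x (p.1, p.2) * ((p.1 == i)%:R * f p.2) by apply: eq_bigr => -[].
rewrite -(pair_bigA _ (fun i' l => x (i', l) * ((i' == i)%:R * f l))) /=.
rewrite (bigD1 i) //= [X in _ + X]big1 ?addr0 => [|i' /negPf i'i].
  by apply: eq_bigr => l _; rewrite eqxx mul1r.
by rewrite big1 // => l _; rewrite i'i mul0r mulr0.
Qed.

(* The kernel of a rational matrix over R is spanned by its kernel over Q. *)
Lemma rational_solution (R : realType) (I J : finType) (a : I -> J -> rat)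
    (c : I -> rat) (x : I -> R) :
  (forall j, \sum_i x i * ratr (a i j) = 0) -> \sum_i x i * ratr (c i) != 0 ->
  exists y : I -> rat,
    (forall j, \sum_i y i * a i j = 0) /\ \sum_i y i * c i != 0.
Proof.
move=> xa xc.
pose A := \matrix_(i < #|I|, j < #|J|) a (enum_val i) (enum_val j).
pose C := \col_(i < #|I|) c (enum_val i).
pose v := \row_(i < #|I|) x (enum_val i).
have sumI (V : nmodType) (F : I -> V) : \sum_(i < #|I|) F (enum_val i) = \sum_i F i.
  by rewrite -big_enum_val; apply: eq_bigl.
(* Kernels commute with extension of scalars, so the real solution [v] is a real combination of
   rational ones. If [C] vanished on all of those, it would vanish on [v]. *)
have vA : (v <= map_mx ratr (kermx A))%MS.
  rewrite map_kermx; apply/sub_kermxP/rowP => j; rewrite [RHS]mxE -(xa (enum_val j)).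
  by rewrite mxE -sumI; apply: eq_bigr => i _; rewrite !mxE.
have [KC|nKC] := eqVneq (kermx A *m C) 0.
  case/eqP: xc; case/submxP: vA => w vE.
  have : (v *m map_mx ratr C) 0 0 = 0.
    by rewrite vE -mulmxA -map_mxM KC map_mx0 mulmx0 mxE.
  by rewrite mxE => e; rewrite -[RHS]e -sumI; apply: eq_bigr => i _; rewrite !mxE.
have [i Ki] : exists i, row i (kermx A *m C) != 0.
  apply: contrapT => /forallNP nK; case/eqP: nKC; apply/row_matrixP => i.
  by rewrite row0; apply/eqP; apply: contrapT => /negP; apply: nK.
pose y := row i (kermx A).
have ysum (F : I -> rat) : \sum_i y 0 (enum_rank i) * F i = 
    \sum_(i < #|I|) y 0 i * F (enum_val i).
  by rewrite -sumI; apply: eq_bigr => l _; rewrite enum_valK.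
exists (fun l => y 0 (enum_rank l)); split=> [j|].
  rewrite ysum; have : (y *m A) 0 (enum_rank j) = 0.
    by rewrite -row_mul mulmx_ker row0 mxE.
  rewrite mxE => e; rewrite -[RHS]e; apply: eq_bigr => l _.
  by rewrite [A _ _]mxE enum_rankK.
rewrite ysum; apply: contra_neq Ki => e.
apply/rowP => z; rewrite row_mul ord1 [LHS]mxE [RHS]mxE -[RHS]e.
by apply: eq_bigr => l _; rewrite [C _ _]mxE.
Qed.

(** * Skew operators are multiples of [sigma] modulo the centre *)

Section Skew.
Variable R : realType.
Implicit Types (T B : 'M[R]_8) (x y : h R).

Definition skew T := forall x y : h R,
  [lie (x *m T : h R), y] = - [lie x, (y *m T : h R)].

(* T = c * sigma modulo the centre (the last four coordinates). *)
Definition twist T (c : R) := forall x : h R,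
  [/\ coord (x *m T) 0 = c * coord x 0, coord (x *m T) 1 = c * coord x 1,
      coord (x *m T) 2 = - (c * coord x 2) & coord (x *m T) 3 = - (c * coord x 3)].

Lemma coord_mulmx (K : fieldType) (x : 'rV[K]_8) (T : 'M[K]_8) j :
  coord (x *m T) j = \sum_(i < 8) coord x i * coord (delta_mx 0 i *m T) j.
Proof.
by rewrite /coord mxE; apply: eq_bigr => i _; rewrite -rowE mxE inord_val.
Qed.

(** Skewness is tested on pairs of basis vectors. A pair with a central vector shows that the centre
    is preserved, a pair inside one plane that the planes do not mix, and pairs from different
    planes that [T] acts on the planes by opposite scalars. *)
Lemma skew_twist T : skew T -> exists c, twist T c.
Proof.
move=> HT; pose P i j := coord (delta_mx 0 (inord i) *m T) j.
have F q r i j : (q < 2)%N -> (2 <= r < 4)%N -> (i < 8)%N -> (j < 8)%N ->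
    P i q * (r == j)%N%:R - P i r * (q == j)%N%:R =
    (r == i)%N%:R * P j q - (q == i)%N%:R * P j r.
  move=> q2 r4 i8 j8.
  (* Coordinate [2 * q + r + 2] of a bracket in [h] is the minor on the coordinates [q] and [r]. *)
  have := congr1 (fun v : 'rV_8 => coord v (q + q + r).+2)
    (HT (delta_mx 0 (inord i)) (delta_mx 0 (inord j))).
  move: q2 r4; case: q => [|[|//]] _; case: r => [|[|[|[|//]]]] // _;
  by rewrite coordN ?(h_lie4, h_lie5, h_lie6, h_lie7) !coord_delta // opprB.
have Z i : (4 <= i < 8)%N ->
    [/\ P i 0%N = 0, P i 1%N = 0, P i 2%N = 0 & P i 3%N = 0].
  case/andP=> i4 i8.
  have := F 0%N 2%N i 2%N isT isT i8 isT; have := F 1%N 2%N i 2%N isT isT i8 isT.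
  have := F 0%N 2%N i 0%N isT isT i8 isT; have := F 0%N 3%N i 0%N isT isT i8 isT.
  by move: i4; do 4! [case: i i8 => // i i8] => _ /=; split; lra.
have [P02 P03 P12 P13] :
    [/\ P 0%N 2%N = 0, P 0%N 3%N = 0, P 1%N 2%N = 0 & P 1%N 3%N = 0].
  have := F 0%N 2%N 0%N 1%N isT isT isT isT; have := F 0%N 3%N 0%N 1%N isT isT isT isT.
  have := F 1%N 2%N 0%N 1%N isT isT isT isT; have := F 1%N 3%N 0%N 1%N isT isT isT isT.
  by move=> /=; split; lra.
have [P20 P21 P30 P31] :
    [/\ P 2%N 0%N = 0, P 2%N 1%N = 0, P 3%N 0%N = 0 & P 3%N 1%N = 0].
  have := F 0%N 2%N 2%N 3%N isT isT isT isT; have := F 0%N 3%N 2%N 3%N isT isT isT isT.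
  have := F 1%N 2%N 2%N 3%N isT isT isT isT; have := F 1%N 3%N 2%N 3%N isT isT isT isT.
  by move=> /=; split; lra.
have [P01 P23 P22] :
    [/\ P 0%N 1%N = 0, P 2%N 3%N = 0 & P 2%N 2%N = - P 0%N 0%N].
  have := F 0%N 2%N 0%N 2%N isT isT isT isT; have := F 0%N 3%N 0%N 2%N isT isT isT isT.
  by have := F 1%N 2%N 0%N 2%N isT isT isT isT => /=; split; lra.
have [P32 P33] : P 3%N 2%N = 0 /\ P 3%N 3%N = - P 0%N 0%N.
  have := F 0%N 2%N 0%N 3%N isT isT isT isT; have := F 0%N 3%N 0%N 3%N isT isT isT isT.
  by move=> /=; split; lra.
have [P10 P11] : P 1%N 0%N = 0 /\ P 1%N 1%N = P 0%N 0%N.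
  have := F 0%N 2%N 1%N 2%N isT isT isT isT; have := F 1%N 2%N 1%N 2%N isT isT isT isT.
  by move=> /=; split; lra.
have sumP x j : coord (x *m T) j = \sum_(i < 8) coord x i * P i j.
  by rewrite coord_mulmx; apply: eq_bigr => i _; rewrite /P inord_val.
have [Z40 Z41 Z42 Z43] := Z 4%N isT; have [Z50 Z51 Z52 Z53] := Z 5%N isT.
have [Z60 Z61 Z62 Z63] := Z 6%N isT; have [Z70 Z71 Z72 Z73] := Z 7%N isT.
exists (P 0%N 0%N) => x.
split; rewrite sumP big_ord8 !inordK //.
- by rewrite P10 P20 P30 Z40 Z50 Z60 Z70; ring.
- by rewrite P01 P11 P21 P31 Z41 Z51 Z61 Z71; ring.
- by rewrite P02 P12 P22 P32 Z42 Z52 Z62 Z72; ring.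
- by rewrite P03 P13 P23 P33 Z43 Z53 Z63 Z73; ring.
Qed.

End Skew.

(** * A skew operator that preserves a rational form *)

Section RationalOperator.
Variable R : realType.
Implicit Types (T B : 'M[R]_8) (x y : h R).

Lemma twist_lie0 T x y : twist T 0 -> [lie (x *m T : h R), y] = 0.
Proof.
move=> tT; have [e0 e1 e2 e3] := tT x.
by apply: (@coord_inj R _ 0); rewrite !h_lieE coord0 // ?e0 ?e1 ?e2 ?e3; ring.
Qed.

(** Since [sigma ^ 2 = 1], [T ^ 3] and [c ^ 2 * T] agree modulo the centre, which brackets do not
    see. *)
Lemma twist_lie3 T c x y : twist T c ->
  [lie (x *m T *m T *m T : h R), y] = c ^+ 2 *: [lie (x *m T : h R), y].
Proof.
move=> tT; have [e0 e1 e2 e3] := tT x; have [f0 f1 f2 f3] := tT (x *m T).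
have [g0 g1 g2 g3] := tT (x *m T *m T).
by apply: (@coord_inj R); rewrite coordZ !h_lieE ?mulr0 // ?g0 ?g1 ?g2 ?g3
  ?f0 ?f1 ?f2 ?f3; ring.
Qed.

(** The list stops after four entries: the default value 0 of [nth] sends the centre to 0. *)
Definition sigma : 'M[R]_8 := diag_mx (\row_i [:: 1; 1; -1; -1]`_i).

Lemma sigma_twist : twist sigma 1.
Proof.
move=> x; rewrite /coord /sigma mul_mx_diag !mxE !inordK //=.
by split; ring.
Qed.

Lemma sigma_skew : skew sigma.
Proof.
move=> x y; have [e0 e1 e2 e3] := sigma_twist x; have [f0 f1 f2 f3] := sigma_twist y.
by apply: (@coord_inj R); rewrite coordN !h_lieE ?oppr0 // ?e0 ?e1 ?e2 ?e3
  ?f0 ?f1 ?f2 ?f3; ring.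
Qed.

Lemma rows_sum B x : B \in unitmx ->
  x = \sum_i (x *m invmx B) 0 i *: (row i B : h R).
Proof. by move=> uB; rewrite -[LHS](mulmxKV uB) mulmx_sum_row. Qed.

(** By bilinearity, skewness amounts to finitely many linear equations on the matrix of [T] in the
    basis [B]. *)
Lemma rows_skew B T : B \in unitmx ->
  (forall i j, [lie (row i B *m T : h R), row j B] =
    - [lie (row i B : h R), (row j B *m T : h R)]) ->
  skew T.
Proof.
move=> uB H x y; rewrite (rows_sum x uB) (rows_sum y uB).
have mulT (a : 'rV[R]_8) : (\sum_i a 0 i *: (row i B : h R) : 'rV[R]_8) *m T =
    \sum_i a 0 i *: (row i B *m T : h R).
  by rewrite mulmx_suml; apply: eq_bigr => i _; rewrite -scalemxAl.
rewrite !mulT !lie_suml -sumrN; apply: eq_bigr => i _; rewrite -scalerN; congr (_ *: _).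
rewrite !lie_sumr -sumrN; apply: eq_bigr => j _; rewrite -scalerN; congr (_ *: _).
exact: H.
Qed.

Section Form.
Variable B : 'M[R]_8.
Hypothesis uB : B \in unitmx.

Definition in_form (v : h R) := exists q : 'rV[rat]_8, v = map_mx ratr q *m B.

Hypothesis lieB : forall u v, in_form u -> in_form v -> in_form [lie u, v].

Lemma in_form_row i : in_form (row i B).
Proof. by exists (delta_mx 0 i); rewrite map_delta_mx -rowE. Qed.

Lemma form_operator_of_matrix (t : 'M[rat]_8) (T := invmx B *m map_mx ratr t *m B) v :
  in_form v -> in_form (v *m T).
Proof.
case=> q ->; exists (q *m t).
by rewrite /T !mulmxA (mulmxK uB) map_mxM.
Qed.

(* The matrix t of a skew T in the basis B solves a linear system over Q in the
   structure constants s.  Over R, sigma is a solution for which some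
   [b_i0 T, b_j0] does not vanish, hence so does a rational t.  Then c ^ 2 is the
   ratio of the vectors [b_i0 T^3, b_j0] and [b_i0 T, b_j0] of the form. *)
Lemma rational_twist : exists T c, [/\ twist T c, c != 0,
  (exists r : rat, c ^+ 2 = ratr r) & forall v, in_form v -> in_form (v *m T)].
Proof.
have [s sE] : exists s : 'I_8 * 'I_8 -> 'rV[rat]_8, forall p,
    [lie (row p.1 B : h R), (row p.2 B : h R)] = map_mx ratr (s p) *m B.
  have /choice[s sP] : forall p : 'I_8 * 'I_8, exists q : 'rV[rat]_8,
      [lie (row p.1 B : h R), (row p.2 B : h R)] = map_mx ratr q *m B.
    by move=> p; apply: lieB; apply: in_form_row.
  by exists s.
(* The unknown [p] is an entry of the matrix of [T] in the basis [B]; the equation [(i, j, m)] is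
   coordinate [m] of [[b_i T, b_j] + [b_i, b_j T] = 0]. *)
pose a (p : 'I_8 * 'I_8) (j : 'I_8 * 'I_8 * 'I_8) : rat :=
  (p.1 == j.1.1)%:R * s (p.2, j.1.2) 0 j.2
    + (p.1 == j.1.2)%:R * s (j.1.1, p.2) 0 j.2.
have rowT (t : 'M[R]_8) i : row i B *m (invmx B *m t *m B) = \sum_l t i l *: row l B.
  rewrite !mulmxA -!row_mul mulmxV // mul1mx row_mul mulmx_sum_row.
  by apply: eq_bigr => l _; rewrite mxE.
have lieTl (t : 'M[R]_8) i j :
    [lie (row i B *m (invmx B *m t *m B) : h R), row j B] =
    (\row_m \sum_l t i l * ratr (s (l, j) 0 m)) *m B.
  rewrite rowT lie_suml mulmx_sum_row;
  under eq_bigr do rewrite (sE (_, _)) mulmx_sum_row.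
  under eq_bigr do rewrite scaler_sumr;
  rewrite exchange_big; apply: eq_bigr => m _.
  by rewrite mxE scaler_suml; apply: eq_bigr => l _; rewrite scalerA mxE.
have lieTr (t : 'M[R]_8) i j :
    [lie (row i B : h R), (row j B *m (invmx B *m t *m B) : h R)] =
    (\row_m \sum_l t j l * ratr (s (i, l) 0 m)) *m B.
  rewrite rowT lie_sumr mulmx_sum_row;
  under eq_bigr do rewrite (sE (_, _)) mulmx_sum_row.
  under eq_bigr do rewrite scaler_sumr;
  rewrite exchange_big; apply: eq_bigr => m _.
  by rewrite mxE scaler_suml; apply: eq_bigr => l _; rewrite scalerA mxE.
pose t0 := B *m sigma *m invmx B.
have t0E : invmx B *m t0 *m B = sigma.
  by rewrite /t0 !mulmxA mulVmx // mul1mx mulmxKV.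
have [i0 [j0 nz]] : exists i j, [lie (row i B *m sigma : h R), row j B] <> 0.
  apply: contrapT => nex.
  have H i j : [lie (row i B *m sigma : h R), row j B] = 0.
    by apply: contrapT => nz; apply: nex; exists i, j.
  (* If all these brackets vanished, so would [[e0 sigma, e2]], whose coordinate 4 is 1. *)
  pose e0 : h R := delta_mx 0 (inord 0); pose e2 : h R := delta_mx 0 (inord 2).
  have : [lie (e0 *m sigma : h R), e2] = 0.
    rewrite (rows_sum e0 uB) (rows_sum e2 uB).
    rewrite mulmx_suml; under eq_bigr do rewrite -scalemxAl.
    rewrite lie_suml big1 // => i _; rewrite lie_sumr big1 ?scaler0 // => j _.
    by rewrite H scaler0.
  move=> /(congr1 (fun v : 'rV_8 => coord v 4)); rewrite h_lie4 coord0.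
  have [-> _ -> _] := sigma_twist e0.
  by rewrite !coord_delta //= !mulr0 subr0 !mulr1 => /eqP; rewrite oner_eq0.
have [m0 nz0] : exists m, \sum_l t0 i0 l * ratr (s (l, j0) 0 m) != 0.
  apply: contrapT => /forallNP nm; apply: nz; rewrite -t0E lieTl.
  rewrite [X in X *m _](_ : _ = 0) ?mul0mx //; apply/rowP => m; rewrite !mxE.
  by apply/eqP; apply: contrapT => /negP; apply: nm.
pose c0 (p : 'I_8 * 'I_8) : rat := (p.1 == i0)%:R * s (p.2, j0) 0 m0.
have := @rational_solution R _ _ a c0 (fun p => t0 p.1 p.2).
case.
- move=> [[i j] m]; rewrite /a /=.
  under eq_bigr do rewrite rmorphD !rmorphM !rmorph_nat mulrDr.
  rewrite big_split /= (sum_pair_pick (fun p => t0 p.1 p.2) i (fun l => ratr (s (l, j) 0 m))).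
  rewrite (sum_pair_pick (fun p => t0 p.1 p.2) j (fun l => ratr (s (i, l) 0 m))) /=.
  have := sigma_skew (row i B) (row j B); rewrite -t0E lieTl lieTr => /eqP.
  rewrite -subr_eq0 opprK -mulmxDl => /eqP e.
  have /(congr1 (mulmx^~ (invmx B))) := e; rewrite /= mulmxK // mul0mx.
  by move=> /rowP /(_ m); rewrite !mxE.
- rewrite /c0; under eq_bigr do rewrite rmorphM rmorph_nat.
  by rewrite (sum_pair_pick (fun p => t0 p.1 p.2) i0 (fun l => ratr (s (l, j0) 0 m0))).
move=> y [ya yc]; pose t := \matrix_(i, l) y (i, l).
pose T := invmx B *m map_mx ratr t *m B.
have TW v : in_form v -> in_form (v *m T) by apply: form_operator_of_matrix.
have skT : skew T.
  apply: (rows_skew uB) => i j; rewrite lieTl lieTr -mulNmx; congr (_ *m _).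
  apply/rowP => m; rewrite !mxE; apply/eqP; rewrite -subr_eq0 opprK.
  have := ya (i, j, m); rewrite /a /=.
  under eq_bigr do rewrite mulrDr.
  rewrite big_split /= (sum_pair_pick y i (fun l => s (l, j) 0 m)).
  rewrite (sum_pair_pick y j (fun l => s (i, l) 0 m)) => /(congr1 (ratr : rat -> R)).
  rewrite rmorph0 rmorphD !rmorph_sum /= => e; apply/eqP; rewrite -[RHS]e;
    congr (_ + _);
    by apply: eq_bigr => l _; rewrite !mxE rmorphM.
have [c tT] := skew_twist skT.
have vnz : [lie (row i0 B *m T : h R), row j0 B] != 0.
  apply: contra_neq yc => v0; move: v0; rewrite lieTl.
  move=> /(congr1 (mulmx^~ (invmx B))); rewrite /= mulmxK // mul0mx.
  move=> /rowP /(_ m0); rewrite !mxE /c0 (sum_pair_pick y i0 (fun l => s (l, j0) 0 m0)) => e.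
  apply: (fmorph_inj (ratr : {rmorphism rat -> R})); rewrite rmorph0 -[RHS]e rmorph_sum.
  by apply: eq_bigr => l _; rewrite !mxE rmorphM.
exists T, c; split=> //.
  by apply: contra_neq vnz => c_0; apply: twist_lie0; rewrite -c_0.
have W1 := in_form_row i0; have W2 := in_form_row j0.
have [p pE] := lieB (TW _ W1) W2.
have [p' p'E] := lieB (TW _ (TW _ (TW _ W1))) W2.
have pp' : map_mx ratr p' = c ^+ 2 *: map_mx ratr p.
  have := twist_lie3 (row i0 B) (row j0 B) tT; rewrite pE p'E scalemxAl.
  by move=> /(congr1 (mulmx^~ (invmx B))); rewrite /= !mulmxK.
have [m pm] : exists m, p 0 m != 0.
  apply: contrapT => /forallNP nm; case/eqP: vnz; rewrite pE.
  rewrite [p](_ : _ = 0) ?map_mx0 ?mul0mx //; apply/rowP => m; rewrite !mxE.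
  by apply/eqP; apply: contrapT => /negP; apply: nm.
exists (p' 0 m / p 0 m); have /rowP/(_ m) := pp'; rewrite !mxE fmorph_div /= => ->.
by rewrite mulfK // fmorph_eq0.
Qed.

Lemma rational_twist_square_free : exists (k : nat) T c,
  [/\ square_free k, c ^+ 2 = k%:R, twist T c & forall v, in_form v -> in_form (v *m T)].
Proof.
have [T [c [tT c0 [r rE] TW]]] := rational_twist.
(* Here it matters that [c] is real: its square is positive, so [k] will be a natural number. *)
have r0 : 0 < r by rewrite -(@ltr0q R) -rE exprn_even_gt0.
pose a := `|numq r|%N; pose b := `|denq r|%N.
have a0 : (0 < a)%N by rewrite absz_gt0 numq_eq0 gt_eqF.
have b0 : (0 < b)%N by rewrite absz_gt0 denq_neq0.
have rab : r = a%:R / b%:R.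
  rewrite -{1}(divq_num_den r) /a /b !natr_absz !ger0_norm ?denq_ge0 //.
  by rewrite numq_ge0 ltW.
have [m [k [m0 sk abE]]] := @square_free_part (a * b) ltac:(by rewrite muln_gt0 a0).
(* With [c ^ 2 = a / b] and [a * b = m ^ 2 * k], the factor [b / m] turns [c ^ 2] into
   [a * b / m ^ 2 = k]. *)
pose l : rat := b%:R / m%:R.
have mR : m%:R != 0 :> R by rewrite pnatr_eq0 -lt0n.
have bR : b%:R != 0 :> R by rewrite pnatr_eq0 -lt0n.
exists k, (ratr l *: T), (ratr l * c); split=> //.
- rewrite exprMn rE rab /l !fmorph_div !rmorph_nat.
  have /(congr1 (fun n => n%:R : R)) := abE; rewrite -mulnn !natrM => e.
  have -> : (k%:R : R) = (a%:R * b%:R) / m%:R ^+ 2 by rewrite e; field.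
  by field; rewrite mR bR.
- by move=> x; have [e0 e1 e2 e3] := tT x; rewrite -scalemxAr !coordZ e0 e1 e2 e3;
    split; ring.
- move=> v /TW [q qE]; exists (l *: q).
  by rewrite -scalemxAr qE map_mxZ scalemxAl.
Qed.

(* A group is not the union of two proper subgroups. *)
Lemma in_form_generic (F G : 'cV[R]_8) : F != 0 -> G != 0 ->
  exists v, [/\ in_form v, v *m F != 0 & v *m G != 0].
Proof.
have ex (H : 'cV[R]_8) : H != 0 -> exists2 v, in_form v & v *m H != 0.
  move=> H0; have BH : B *m H != 0.
    by apply: contra_neq H0 => BH; rewrite -(mulKmx uB H) BH mulmx0.
  apply: contrapT => nex; case/eqP: BH; apply/row_matrixP => i.
  rewrite row0 row_mul; apply/eqP; apply: contrapT => /negP nz; apply: nex.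
  by exists (row i B) => //; apply: in_form_row.
move=> /ex [u Wu uF] /ex [v Wv vG].
have [uG|uG] := eqVneq (u *m G) 0; last by exists u.
have [vF|vF] := eqVneq (v *m F) 0; last by exists v.
exists (u + v); split; last 2 first.
- by rewrite mulmxDl vF addr0.
- by rewrite mulmxDl uG add0r.
case: Wu Wv => p -> [q ->]; exists (p + q).
by rewrite map_mxD mulmxDl.
Qed.

End Form.
End RationalOperator.

(** * Every square-free [k] occurs, and every rational form is of this kind *)

Section MainParts.
Variable R : realType.

Lemma embed_form_isomorphic (k : int) (E : 'M[R]_8) : E \in unitmx ->
  (forall x y : hQ k, embed E [lie x, y] = [lie embed E x, embed E y]) ->
  form_isomorphic (range (@embed R k E)) (hQ k).
Proof.
move=> uE lieE; exists (embed E : {linear hQ k -> h R | ratr \; *:%R}).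
by split=> //; apply: embed_inj.
Qed.

Lemma square_free_gt0 k : square_free k -> (0 : R) < k%:R.
Proof. by case=> k0 _; rewrite ltr0n. Qed.

Lemma square_free_rational_form (k : nat) : square_free k ->
  exists W : set (h R), rational_form W /\ form_isomorphic W (hQ k%:Z).
Proof.
move=> /square_free_gt0 k0; pose c : R := Num.sqrt k%:R.
have c2 : c ^+ 2 = k%:R by rewrite sqr_sqrtr // ltW.
have c0 : c != 0 by rewrite -(sqrf_eq0 c) c2 gt_eqF.
pose e i : h R := basisX R i.
have co i j : (i < 8)%N -> (j < 8)%N -> coord (e i.+1) j = (j == i)%N%:R.
  exact: coord_basisX.
(* [X1] and [X3] project to the standard basis of each plane, so both determinants of [frame_unit]
   are 1; [X2] is [sigma X1 / c] and [X4] is [c * sigma X3]. *)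
pose X1 := e 1%N + e 3%N; pose X2 := c^-1 *: (e 1%N - e 3%N).
pose X3 := e 2%N + e 4%N; pose X4 := c *: (e 2%N - e 4%N).
have uE : frame X1 X2 X3 X4 \in unitmx.
  apply: (frame_unit c0); rewrite ?(coordD, coordZ, coordN) !co //=;
    try ring; by rewrite !(mulr0, mul0r, mulr1, addr0, add0r, subr0) oner_eq0.
have lieE (x y : hQ k) : embed (frame X1 X2 X3 X4) [lie x, y] =
    [lie embed (frame X1 X2 X3 X4) x, embed (frame X1 X2 X3 X4) y].
  by apply: (frame_lie c0) => //; rewrite !(coordD, coordZ, coordN) !co //=; ring.
exists (range (@embed R k (frame X1 X2 X3 X4))); split.
  exact: embed_rational_form.
exact: embed_form_isomorphic.
Qed.

(** For fixed [X1], the determinants of [frame_unit] are functionals of [X3] of this shape, written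
    as columns to suit [in_form_generic]. *)
Lemma mulmx_functional (v : 'rV[R]_8) (a b : R) i j :
  v *m (a *: delta_mx (inord i) 0 + b *: delta_mx (inord j) 0) =
    (a * coord v i + b * coord v j)%:M :> 'M_1.
Proof.
apply/matrixP => r s; rewrite !ord1 mulmxDr -!scalemxAr -!colE !mxE eqxx.
by rewrite mulr1n.
Qed.

Lemma functional_neq0 (a b : R) i j : (i < 8)%N -> (j < 8)%N -> i != j ->
  a != 0 -> a *: delta_mx (inord i) 0 + b *: delta_mx (inord j) 0 != 0 :> 'cV[R]_8.
Proof.
move=> i8 j8 ij; apply: contra_neq => /matrixP/(_ (inord i) 0).
by rewrite !mxE !eqxx -val_eqE /= !inordK // (negPf ij) mulr1 mulr0 addr0.
Qed.

(** The rational matrix [M] that expresses [E] through [B] is invertible over the reals, hence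
    already over the rationals, so the rows of [E] and [B] have the same rational span. *)
Lemma in_form_embed (k : int) (B E : 'M[R]_8) : E \in unitmx ->
  B \in unitmx -> (forall i, in_form B (row i E)) ->
  range (@embed R k E) = in_form B.
Proof.
move=> uE uB /choice[m mE].
pose M := \matrix_i m i.
have EM : E = map_mx ratr M *m B.
  by apply/row_matrixP => i; rewrite mE row_mul -map_row rowK.
have uM : M \in unitmx.
  by move: uE; rewrite EM unitmx_mul uB andbT map_unitmx.
apply/seteqP; split=> [_ [x _ <-]|_ [q ->]] /=.
  by exists (x *m M); rewrite /embed EM mulmxA map_mxM.
exists (q *m invmx M) => //.
by rewrite /embed EM mulmxA -map_mxM mulmxKV.
Qed.

Lemma rational_form_square_free (W : set (h R)) : rational_form W ->
  exists k : nat, square_free k /\ form_isomorphic W (hQ k%:Z).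
Proof.
move=> rW; have [B uB WE] := rational_form_rows rW.
have {}WE : W = in_form B by exact: WE.
case: rW => [[W0 Wl] Wlie _]; rewrite {}WE in W0 Wl Wlie *.
have [k [T [c [sk c2 tT TW]]]] := rational_twist_square_free uB Wlie.
have k0 := square_free_gt0 sk.
have c0 : c != 0 by rewrite -(sqrf_eq0 c) c2 gt_eqF.
have WZ (q : rat) v : in_form B v -> in_form B (ratr q *: v).
  by move=> Wv; rewrite -[_ *: v]addr0; apply: Wl.
have o0 : (1 : R) != 0 by rewrite oner_eq0.
(* Nonzero coordinates 0 and 2 of [X1] ensure that the two determinants are nonzero functionals of
   [X3]. *)
have [X1 [WX1 p0 p2]] := in_form_generic uB
  (@functional_neq0 1 0 0 1 isT isT isT o0) (@functional_neq0 1 0 2 3 isT isT isT o0).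
move: p0 p2; rewrite !mulmx_functional !mul1r !mul0r !addr0 => p0 p2.
have {}p0 : coord X1 0 != 0 by apply: contra_neq p0 => ->; rewrite raddf0.
have {}p2 : coord X1 2 != 0 by apply: contra_neq p2 => ->; rewrite raddf0.
have [X3 [WX3 D1 D2]] := in_form_generic uB
  (@functional_neq0 _ (- coord X1 1) 1 0 isT isT isT p0)
  (@functional_neq0 _ (- coord X1 3) 3 2 isT isT isT p2).
move: D1 D2; rewrite !mulmx_functional => D1 D2.
have {}D1 : coord X1 0 * coord X3 1 - coord X3 0 * coord X1 1 != 0.
  apply: contra_neq D1 => D1; rewrite -[RHS](raddf0 (@scalar_mx R 1)) -D1.
  by congr (_%:M); ring.
have {}D2 : coord X1 2 * coord X3 3 - coord X3 2 * coord X1 3 != 0.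
  apply: contra_neq D2 => D2; rewrite -[RHS](raddf0 (@scalar_mx R 1)) -D2.
  by congr (_%:M); ring.
(* Dividing by the rational [k] instead of [c] keeps [X2] in the form; as [T] is [c * sigma] modulo
   the centre and [c ^+ 2 = k], this is still [sigma X1 / c] there. *)
pose X2 : h R := k%:R^-1 *: (X1 *m T); pose X4 : h R := X3 *m T.
have WX4 : in_form B X4 by apply: TW.
have WX2 : in_form B X2.
  by rewrite /X2 -(ratr_nat R) -fmorphV; apply: WZ; apply: TW.
have [e0 e1 e2 e3] := tT X1; have [f0 f1 f2 f3] := tT X3.
have ck (u : R) : k%:R^-1 * (c * u) = u / c by rewrite -c2; field.
have uE : frame X1 X2 X3 X4 \in unitmx.
  by apply: (frame_unit c0) => //; rewrite ?coordZ ?e0 ?e1 ?e2 ?e3 ?mulrN ?ck.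
have lieE (x y : hQ k) : embed (frame X1 X2 X3 X4) [lie x, y] =
    [lie embed (frame X1 X2 X3 X4) x, embed (frame X1 X2 X3 X4) y].
  by apply: (frame_lie c0) => //; rewrite ?coordZ ?e0 ?e1 ?e2 ?e3 ?mulrN ?ck.
exists k; split=> //.
rewrite -(in_form_embed k%:Z uE uB); first exact: embed_form_isomorphic.
have W1 : in_form B (- [lie X2, X3]).
  by rewrite -scaleN1r -(rmorphN1 (ratr : {rmorphism rat -> R})); apply: WZ; apply: Wlie.
move=> i; rewrite rowK; case: i; do 8! [case=> /=; first by move=> _; try exact: Wlie].
by [].
Qed.

End MainParts.

(** * The class of [k] modulo rational squares is an invariant of [hQ k] *)

(* Multiplication by a square root of k, modulo the centre. *)
Definition hQ_sqrt (k : int) (x : hQ k) : hQ k :=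
  \row_i [:: coord x 1; k%:~R * coord x 0; k%:~R * coord x 3; coord x 2]`_i.

Lemma coord_hQ_sqrt k (x : hQ k) : [/\ coord (hQ_sqrt x) 0 = coord x 1,
  coord (hQ_sqrt x) 1 = k%:~R * coord x 0, coord (hQ_sqrt x) 2 = k%:~R * coord x 3
  & coord (hQ_sqrt x) 3 = coord x 2].
Proof. by rewrite /coord !mxE !inordK. Qed.

Lemma hQ_sqrt_skew k (x y : hQ k) : [lie hQ_sqrt x, y] = - [lie x, hQ_sqrt y].
Proof.
have [e0 e1 e2 e3] := coord_hQ_sqrt x; have [f0 f1 f2 f3] := coord_hQ_sqrt y.
by apply: (@coord_inj rat); rewrite coordN !hQ_lieE ?e0 ?e1 ?e2 ?e3 ?f0 ?f1 ?f2 ?f3;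
  ring.
Qed.

Lemma hQ_sqrt_sqr k (x y : hQ k) :
  [lie hQ_sqrt (hQ_sqrt x), y] = k%:~R *: [lie x, y].
Proof.
have [e0 e1 e2 e3] := coord_hQ_sqrt x.
have [f0 f1 f2 f3] := coord_hQ_sqrt (hQ_sqrt x).
by apply: (@coord_inj rat); rewrite coordZ !hQ_lieE ?f0 ?f1 ?f2 ?f3 ?e0 ?e1 ?e2 ?e3;
  ring.
Qed.

(* Skewness turns [P (P X_1), X_2] into - [P X_1, P X_2], and the first three
   basis vectors suffice to determine P X_1 and P X_2 up to a scalar in the
   coordinates X_1 and X_2. *)
Lemma hQ_skew_sqr k (P : hQ k -> hQ k) (d : rat) :
  (forall x y, [lie P x, y] = - [lie x, P y]) ->
  (forall x y, [lie P (P x), y] = d *: [lie x, y]) ->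
  exists c : rat, d = c ^+ 2 * k%:~R.
Proof.
move=> sP dP; pose e i : hQ k := delta_mx 0 (inord i).
have ce i j : (i < 8)%N -> (j < 8)%N -> coord (e i) j = (j == i)%N%:R.
  exact: coord_delta.
have F (a b : hQ k) j : a = - b -> coord a j = - coord b j by move=> ->; rewrite coordN.
have := F _ _ 4 (sP (e 0%N) (e 1%N)); have := F _ _ 7 (sP (e 0%N) (e 2%N)).
have := F _ _ 6 (sP (e 0%N) (e 2%N)); have := F _ _ 5 (sP (e 0%N) (e 2%N)).
have := F _ _ 5 (sP (e 1%N) (e 2%N)); have := F _ _ 6 (sP (e 1%N) (e 2%N)).
have := congr1 (fun v : 'rV_8 => coord v 4) (dP (e 0%N) (e 1%N)).
rewrite sP coordN coordZ !hQ_lieE !ce //=.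
rewrite !(mulr0, mulr1, mul0r, mul1r, subr0, sub0r, addr0, add0r, oppr0, opprK).
move=> dE G1 G2 G3 G4 G5 G6.
exists (coord (P (e 1%N)) 0).
have P00 : coord (P (e 0%N)) 0 = 0 by lra.
have P01 : coord (P (e 0%N)) 1 = k%:~R * coord (P (e 1%N)) 0.
  have -> : coord (P (e 1%N)) 0 = coord (P (e 2%N)) 3 by lra.
  by lra.
(* By [dE], [d] is minus the minor of [P X_1] and [P X_2] on the first two coordinates; since [P00]
   vanishes, it is the product of the two off-diagonal entries. *)
by rewrite -dE P00 P01; ring.
Qed.

(** An isomorphism carries the square root of [k] on [hQ k] to a skew map on [hQ k'] whose square
    still acts as [k] inside brackets; [hQ_skew_sqr] then applies with [d = k]. *)
Lemma hQ_isomorphic_square (k k' : int) : lie_isomorphic (hQ k) (hQ k') ->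
  exists c : rat, k%:~R = c ^+ 2 * k'%:~R.
Proof.
case=> g [[g' gK g'K] gL].
apply: (@hQ_skew_sqr k' (fun x => g (hQ_sqrt (g' x)))) => x y.
  by rewrite -{1}(g'K y) -gL hQ_sqrt_skew -{2}(g'K x) -gL raddfN.
by rewrite gK -{1}(g'K y) -gL hQ_sqrt_sqr linearZ gL !g'K.
Qed.

Theorem proposition2p13 (R : realType) :
  [/\ forall k : nat, square_free k ->
        exists W : set (h R), rational_form W /\ form_isomorphic W (hQ k%:Z),
      forall W : set (h R), rational_form W ->
        exists k : nat, square_free k /\ form_isomorphic W (hQ k%:Z) &
      forall k k' : nat, square_free k -> square_free k' -> k <> k' ->
        ~ lie_isomorphic (hQ k%:Z) (hQ k'%:Z)].
Proof.
split; [exact: square_free_rational_form|exact: rational_form_square_free|].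
move=> k k' sk sk' kk' /hQ_isomorphic_square[c ckk'].
exact: kk' (square_free_inj sk sk' ckk').
Qed.
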